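(* Let $(\mathcal{T}_n)$ be a family of trees, where $\mathcal{T}_n$ has $n$ vertices and $n$ ranges over an infinite set of positive integers, such that the complement $\overline{\mathcal{T}_n}$ is connected. Then \[ \mathcal{K}(\mathcal{T}_n)\,\mathcal{K}(\overline{\mathcal{T}_n})=O(n^3). \]
   Context: Graphs are finite, simple, undirected and unweighted. $\overline{G}$ is the complement of $G$. For a connected graph $G$ with vertex set $\{1,\dots,n\}$, $m$ edges and vertex degrees $d_1,\dots,d_n$, Kemeny's constant is $\mathcal{K}(G)=\sum_{j\neq i}\frac{d_j}{2m}\,m_{i,j}$, where $m_{i,j}$ is the expected first time at which the simple random walk on $G$ (which moves at each step to a uniformly random neighbour) started at $i$ reaches $j$; this value does not depend on the choice of $i$. Asymptotic notation: $f(G_n)=O(g(n))$ means $\limsup_{n\to\infty} f(G_n)/g(n)$ is finite. *)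

(* Defs.v *)
From mathcomp Require Import all_boot all_order all_algebra.
From mathcomp Require Import all_classical all_reals all_analysis.

Set Implicit Arguments.
Unset Strict Implicit.
Unset Printing Implicit Defensive.

Import Order.TTheory GRing.Theory Num.Theory.

Local Open Scope ring_scope.

(* Finite simple graphs are symmetric irreflexive relations on a finType. *)
Section Graphs.
Variable V : finType.
Implicit Types e : rel V.

Definition simple_graph e : Prop := symmetric e /\ irreflexive e.

Definition compl_graph e : rel V := [rel x y | (x != y) && ~~ e x y].

Definition connected_graph e : Prop :=
  (0 < #|V|)%N /\ forall x y : V, connect e x y.

(* A closed walk without repeated vertices is a graph cycle only if it visits
   at least three vertices: in a symmetric relation every edge {x, y} already
   gives the two-vertex ucycle [:: x; y]. *)
Definition acyclic_graph e : Prop :=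
  forall c : seq V, ucycle e c -> (size c <= 2)%N.

Definition tree e : Prop :=
  [/\ simple_graph e, connected_graph e & acyclic_graph e].

Definition degree e (x : V) : nat := #|[set y | e x y]|.

Definition edges e : {set {set V}} :=
  [set [set p.1; p.2] | p in [set p : V * V | e p.1 p.2]].

End Graphs.

Section RandomWalk.
Variables (R : realType) (V : finType).
Implicit Types e : rel V.

Definition step_prob e (x y : V) : R :=
  if e x y then (degree e x)%:R^-1 else 0.

(* Probability that the walk started at x visits s_0, s_1, ... at times
   1, 2, ..., size s. *)
Fixpoint traj_prob e (x : V) (s : seq V) : R :=
  if s is y :: s' then step_prob e x y * traj_prob e y s' else 1.

(* P_i (T_j = t), where T_j is the first time at which the walk is at j: the
   trajectory (X_0, ..., X_t) is i :: w, and index gives the position of the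
   first occurrence of j in it. *)
Definition hit_prob e (i j : V) (t : nat) : R :=
  \sum_(w : t.-tuple V | index j (i :: w) == t) traj_prob e i w.

(* E_i [T_j], for T_j with values in nat U {+oo}: the last term is
   +oo * P_i (T_j = +oo), which is 0 when j is reached almost surely. *)
Definition expected_hit e (i j : V) : \bar R :=
  (\sum_(0 <= t <oo) (t%:R * hit_prob e i j t)%:E
   + +oo * (1 - \sum_(0 <= t <oo) (hit_prob e i j t)%:E))%E.

Definition kemeny_from e (i : V) : \bar R :=
  (\sum_(j | j != i)
     ((degree e j)%:R / (2 * #|edges e|%:R))%:E * expected_hit e i j)%E.

(* For a connected graph kemeny_from e i does not depend on i, so any starting
   vertex may be picked; the default value is reached only if V is empty. *)
Definition kemeny e : \bar R :=
  if [pick i : V] is Some i then kemeny_from e i else 0%E.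

End RandomWalk.

(* Main.v *)
Require Import Defs.
From mathcomp Require Import all_boot all_order all_algebra.
From mathcomp Require Import all_classical all_reals all_analysis.
From mathcomp Require Import zify ring lra.

Set Implicit Arguments.
Unset Strict Implicit.
Unset Printing Implicit Defensive.

Import Order.TTheory GRing.Theory Num.Theory.

Local Open Scope ring_scope.

(** Kemeny's constant is at most [2 n^2] for a tree on [n] vertices, and at most
    [44 n] for a connected complement of a tree with [n >= 4]; the product is
    then at most [88 n^3].  Both bounds are sums over [j] of [d_j / 2m] times a
    bound on the expected hitting time of [j] that does not depend on the
    starting vertex, so that the starting vertex chosen in the definition does
    not matter.

    Hitting times are controlled through the expectations of [min(T_j, t)], which
    obey a one-step recursion in [t]: a bound uniform in [t] shows both that [j]
    is reached almost surely and that the expected hitting time obeys the bound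
    ([expected_hit_bound]).

    In a tree, or in any connected graph, the neighbours of [j] hit [j] in
    expected time at most the total degree ([trunc_hit_neighbour]), since the
    Laplacian of the hitting time sums to zero.  Along a path these times add up
    to at most [n] times the total degree, and a tree has total degree at most
    [2 n] ([tree_total_degree]).

    In the complement, a vertex [j] of degree [k] is hit from anywhere in expected
    time of order [n^2 / k]: within two steps the walk has a chance of order
    [k / n] to be at a neighbour of [j], and from there a chance at least [1 / n]
    to step to [j].  Since a tree has no cycle of length four, at most one
    vertex has few ways into the neighbourhood of [j] ([poor_unique]), and the
    walk leaves that vertex at once.  A function that takes four values turns this
    into a bound ([compl_trunc_hit]).  The weights [k / 2m] cancel the
    denominators [k], and [2m] is of order [n^2] because the tree has few
    edges. *)

(** * The averaging operator of the walk *)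

Definition walk_avg (R : realType) (V : finType) (e : rel V) (h : V -> R)
    (x : V) : R :=
  \sum_y step_prob R e x y * h y.

Lemma step_prob_ge0 (R : realType) (V : finType) (e : rel V) (x y : V) :
  0 <= step_prob R e x y.
Proof. by rewrite /step_prob; case: ifP => // _; rewrite invr_ge0 ler0n. Qed.

Lemma degree_gt0 (V : finType) (e : rel V) (x y : V) :
  e x y -> (0 < degree e x)%N.
Proof. by move=> exy; apply/card_gt0P; exists y; rewrite inE. Qed.

Lemma walk_avgE (R : realType) (V : finType) (e : rel V) (h : V -> R) (x : V) :
  walk_avg e h x = (\sum_(y | e x y) h y) / (degree e x)%:R.
Proof.
rewrite /walk_avg (bigID (e x)) /= [X in _ + X]big1 ?addr0 => [|y /negPf exyN].
  rewrite mulr_suml; apply: eq_bigr => y exy.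
  by rewrite /step_prob exy mulrC.
by rewrite /step_prob exyN mul0r.
Qed.

Lemma sum_neighbour_cst (R : realType) (V : finType) (e : rel V) (c : R) (x : V) :
  \sum_(y | e x y) c = c * (degree e x)%:R.
Proof.
rewrite /degree -sum1dep_card natr_sum mulr_sumr.
by apply: eq_bigr => y _; rewrite mulr1.
Qed.

Lemma walk_avg_cst (R : realType) (V : finType) (e : rel V) (c : R) (x : V) :
  (0 < degree e x)%N -> walk_avg e (fun=> c) x = c.
Proof.
move=> d0; rewrite walk_avgE sum_neighbour_cst.
by rewrite mulfK// pnatr_eq0 -lt0n.
Qed.

Lemma walk_avgD (R : realType) (V : finType) (e : rel V) (h k : V -> R) (x : V) :
  walk_avg e (fun y => h y + k y) x = walk_avg e h x + walk_avg e k x.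
Proof. by rewrite /walk_avg -big_split; apply: eq_bigr => y _; rewrite mulrDr. Qed.

Lemma walk_avgZ (R : realType) (V : finType) (e : rel V) (c : R) (h : V -> R)
    (x : V) :
  walk_avg e (fun y => c * h y) x = c * walk_avg e h x.
Proof. by rewrite /walk_avg mulr_sumr; apply: eq_bigr => y _; rewrite mulrCA. Qed.

Lemma eq_walk_avg (R : realType) (V : finType) (e : rel V) (h k : V -> R)
    (x : V) :
  h =1 k -> walk_avg e h x = walk_avg e k x.
Proof. by move=> hk; apply: eq_bigr => y _; rewrite hk. Qed.

Lemma walk_avg_sum (R : realType) (V : finType) (e : rel V) (h : nat -> V -> R)
    (t : nat) (x : V) :
  walk_avg e (fun y => \sum_(s < t) h s y) x = \sum_(s < t) walk_avg e (h s) x.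
Proof.
rewrite /walk_avg exchange_big /=; apply: eq_bigr => y _.
by rewrite mulr_sumr.
Qed.

Lemma le_walk_avg (R : realType) (V : finType) (e : rel V) (h k : V -> R)
    (x : V) :
  (forall y, e x y -> h y <= k y) -> walk_avg e h x <= walk_avg e k x.
Proof.
move=> hk; rewrite !walk_avgE ler_wpM2r ?invr_ge0//.
by apply: ler_sum => y; apply: hk.
Qed.

Lemma walk_avg_ge0 (R : realType) (V : finType) (e : rel V) (h : V -> R)
    (x : V) :
  (forall y, 0 <= h y) -> 0 <= walk_avg e h x.
Proof.
by move=> h0; apply: sumr_ge0 => y _; rewrite mulr_ge0 ?step_prob_ge0.
Qed.

(** The walk steps into [A], where [h] is smaller by [delta], with probability at
    least [p]. *)
Lemma walk_avg_drop (R : realType) (V : finType) (e : rel V) (h : V -> R)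
    (x : V) (A : pred V) (c delta p : R) :
  (0 < degree e x)%N -> 0 <= delta ->
  (forall y, e x y -> h y <= c) ->
  (forall y, e x y -> A y -> h y <= c - delta) ->
  p * (degree e x)%:R <= #|[set y | e x y & A y]|%:R ->
  walk_avg e h x <= c - delta * p.
Proof.
move=> d0 delta0 hc hA pA; rewrite walk_avgE ler_pdivrMr ?ltr0n//.
have : \sum_(y | e x y) h y <= \sum_(y | e x y) (c - delta * (A y)%:R).
  apply: ler_sum => y exy; case: (boolP (A y)) => Ay; first by rewrite mulr1 hA.
  by rewrite mulr0 subr0 hc.
move=> /le_trans; apply.
rewrite big_split /= sum_neighbour_cst sumrN -mulr_sumr -natr_sum.
have -> : (\sum_(y | e x y) A y)%N = #|[set y | e x y & A y]|.
  by rewrite -sum1dep_card big_mkcondr; apply: eq_bigr => y _; case: (A y).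
by rewrite mulrBl -mulrA lerB// ler_wpM2l.
Qed.

(** * Truncated hitting times *)

(** The expectation of [min(T_j, t)] for the walk started at [x].  If
    every vertex but [j] has a neighbour, then a bound that is uniform in [t] is a
    bound on the expected hitting time, and the recursion makes such bounds
    provable by induction on [t]. *)
Fixpoint trunc_hit (R : realType) (V : finType) (e : rel V) (j : V) (t : nat)
    (x : V) : R :=
  if t is s.+1 then
    if x == j then 0 else 1 + walk_avg e (trunc_hit R e j s) x
  else 0.

Lemma trunc_hit_ge0 (R : realType) (V : finType) (e : rel V) (j : V) (t : nat)
    (x : V) :
  0 <= trunc_hit R e j t x.
Proof.
elim: t x => [|t IH] x //=; case: ifP => // _.
by rewrite addr_ge0// walk_avg_ge0.
Qed.

Lemma trunc_hit_target (R : realType) (V : finType) (e : rel V) (j : V)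
    (t : nat) :
  trunc_hit R e j t j = 0.
Proof. by case: t => //= t; rewrite eqxx. Qed.

Lemma trunc_hit_mono (R : realType) (V : finType) (e : rel V) (j : V) (t : nat)
    (x : V) :
  trunc_hit R e j t x <= trunc_hit R e j t.+1 x.
Proof.
elim: t x => [|t IH] x; first exact: trunc_hit_ge0.
rewrite [leLHS]/= [leRHS]/=; case: ifP => // _.
by rewrite lerD2l; apply: le_walk_avg => y _; apply: IH.
Qed.

(** Optional stopping for the process [h (X_t) + t], in the form of an induction
    on the truncation level. *)
Lemma trunc_hit_le_supersol (R : realType) (V : finType) (e : rel V) (j : V)
    (h : V -> R) :
  (forall x, 0 <= h x) ->
  (forall x, x != j -> 1 + walk_avg e h x <= h x) ->
  forall t x, trunc_hit R e j t x <= h x.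
Proof.
move=> h0 hh; elim=> [|t IH] x //=; case: ifPn => // xj.
by apply: le_trans (hh x xj); rewrite lerD2l; apply: le_walk_avg => y _.
Qed.

Lemma hit_prob_ge0 (R : realType) (V : finType) (e : rel V) (i j : V) (t : nat) :
  0 <= hit_prob R e i j t.
Proof.
apply: sumr_ge0 => w _; elim: (tval w) i => [|y s IH] i //=.
by rewrite mulr_ge0 ?step_prob_ge0.
Qed.

Lemma hit_prob0 (R : realType) (V : finType) (e : rel V) (i j : V) :
  hit_prob R e i j 0 = (i == j)%:R.
Proof.
rewrite /hit_prob; case: eqVneq => [->|ij].
  rewrite (eq_bigl xpredT) => [|w]; last by rewrite /= eqxx.
  rewrite (eq_bigr (fun=> 1)) => [|w _]; last by rewrite tuple0.
  by rewrite sumr_const card_tuple expn0.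
by rewrite big1 // => w; rewrite /= (negPf ij).
Qed.

Lemma hit_prob_target (R : realType) (V : finType) (e : rel V) (j : V)
    (t : nat) :
  hit_prob R e j j t.+1 = 0.
Proof. by rewrite /hit_prob big1 // => w; rewrite /= eqxx. Qed.

(** First-step analysis. *)
Lemma hit_probS (R : realType) (V : finType) (e : rel V) (i j : V) (t : nat) :
  i != j -> hit_prob R e i j t.+1 = walk_avg e (fun y => hit_prob R e y j t) i.
Proof.
move=> ij; rewrite /walk_avg /hit_prob.
pose cons_tup (p : V * t.-tuple V) : t.+1.-tuple V := [tuple of p.1 :: p.2].
rewrite (reindex cons_tup) /=; last first.
  exists (fun w => (thead w, [tuple of behead w])) => [[y w] _|w _] /=.
    by congr (_, _); apply: val_inj.
  by rewrite [RHS](tuple_eta w); apply: val_inj.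
under [RHS]eq_bigr => y _ do rewrite mulr_sumr.
by rewrite pair_big_dep /=; apply: eq_bigl => -[y w] /=; rewrite (negPf ij).
Qed.

(** The identity [E min(T, t) = sum_(s < t) s P (T = s) + t P (T >= t)]. *)
Lemma trunc_hitE (R : realType) (V : finType) (e : rel V) (j : V) (t : nat)
    (x : V) :
  (forall y, y != j -> 0 < degree e y)%N ->
  trunc_hit R e j t x
    = \sum_(s < t) s%:R * hit_prob R e x j s
      + t%:R * (1 - \sum_(s < t) hit_prob R e x j s).
Proof.
move=> dj; elim: t x => [|t IH] x; first by rewrite !big_ord0 mul0r addr0.
rewrite /=; case: eqVneq => [->|xj].
  rewrite !big_ord_recl hit_prob0 eqxx mul0r add0r.
  rewrite !big1 => [|s _|s _]; rewrite ?hit_prob_target ?mulr0//.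
  by rewrite addr0 subrr mulr0 addr0.
rewrite !big_ord_recl hit_prob0 (negPf xj) /= mul0r !add0r.
set F := fun y => \sum_(s < t) hit_prob R e y j s.
set G := fun y => \sum_(s < t) s%:R * hit_prob R e y j s.
have -> : \sum_(i < t) hit_prob R e x j (lift ord0 i) = walk_avg e F x.
  rewrite (walk_avg_sum e (fun s y => hit_prob R e y j s)).
  by apply: eq_bigr => s _; rewrite -hit_probS.
have -> : \sum_(i < t) (lift ord0 i)%:R * hit_prob R e x j (lift ord0 i)
    = walk_avg e G x + walk_avg e F x.
  rewrite (walk_avg_sum e (fun s y => s%:R * hit_prob R e y j s)).
  rewrite (walk_avg_sum e (fun s y => hit_prob R e y j s)) -big_split.
  apply: eq_bigr => s _ /=.
  by rewrite walk_avgZ -hit_probS // /bump add1n -natr1 mulrDl mul1r.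
rewrite (@eq_walk_avg _ _ _ _ (fun y => G y + (t%:R + (- t%:R) * F y))); last first.
  by move=> y; rewrite IH /G /F; ring.
rewrite !walk_avgD walk_avgZ walk_avg_cst; last exact: dj.
by rewrite -natr1; ring.
Qed.

Lemma sum_hit_prob_le1 (R : realType) (V : finType) (e : rel V) (j : V)
    (t : nat) (x : V) :
  (forall y, y != j -> 0 < degree e y)%N ->
  \sum_(s < t) hit_prob R e x j s <= 1.
Proof.
move=> dj; elim: t x => [|t IH] x; first by rewrite big_ord0.
rewrite big_ord_recl hit_prob0; case: eqVneq => [->|xj] /=.
  by rewrite big1 ?addr0// => s _; rewrite hit_prob_target.
rewrite add0r -[leRHS](@walk_avg_cst R V e 1 x); last exact: dj.
under eq_bigr => s _ do rewrite hit_probS//.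
rewrite -(walk_avg_sum e (fun s y => hit_prob R e y j s)).
by apply: le_walk_avg => y _; exact: IH.
Qed.

(** If the truncated expectations stay below [M], then
    [t P (T_j >= t) <= M] for all [t], so that [j] is reached almost surely and
    the term at infinity in the expected hitting time vanishes. *)
Lemma expected_hit_bound (R : realType) (V : finType) (e : rel V) (i j : V)
    (M : R) :
  (forall y, y != j -> 0 < degree e y)%N ->
  (forall t, trunc_hit R e j t i <= M) ->
  (0 <= expected_hit R e i j <= M%:E)%E.
Proof.
move=> dj hM; rewrite /expected_hit.
pose f := hit_prob R e i j.
have f0 s : 0 <= f s by exact: hit_prob_ge0.
have psum (u : nat -> R) t :
    (\sum_(0 <= s < t) (u s)%:E)%E = (\sum_(s < t) u s)%:E.
  by rewrite big_mkord sumEFin.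
have F1 t : \sum_(s < t) f s <= 1 by exact: sum_hit_prob_le1.
have series_le (u : nat -> R) (c : R) : (forall s, 0 <= u s) ->
    (forall t, \sum_(s < t) u s <= c) ->
    (0 <= \sum_(0 <= s <oo) (u s)%:E <= c%:E)%E.
  move=> u0 uc; apply/andP; split; first by apply: nneseries_ge0 => *; rewrite lee_fin.
  apply: lime_le; first by apply: is_cvg_nneseries => *; rewrite lee_fin.
  by apply: nearW => t; rewrite psum lee_fin.
have -> : (\sum_(0 <= t <oo) (f t)%:E)%E = 1%E.
  have /andP[s0 s1] := series_le f 1 f0 F1.
  have sge t : ((\sum_(s < t) f s)%:E <= \sum_(0 <= t <oo) (f t)%:E)%E.
    by rewrite -psum; apply: nneseries_lim_ge => *; rewrite lee_fin.
  move: s0 s1 sge; case: (\sum_(0 <= t <oo) (f t)%:E)%E => [s| |] //.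
  rewrite !lee_fin => s0 s1 sge; congr _%:E; apply/eqP; rewrite eq_le s1 /=.
  rewrite leNgt; apply/negP => slt.
  have d0 : 0 < 1 - s by rewrite subr_gt0.
  pose t := (Num.truncn (M / (1 - s))).+1.
  have Mt : M < t%:R * (1 - s).
    by rewrite -ltr_pdivrMr//; exact: truncnS_gt.
  have := hM t; rewrite leNgt => /negP; apply; apply: (lt_le_trans Mt).
  rewrite trunc_hitE// -[leLHS]add0r lerD//.
    by apply: sumr_ge0 => k _; rewrite mulr_ge0.
  by rewrite ler_wpM2l// lerB// -lee_fin.
rewrite subee// mule0 adde0.
apply: (series_le (fun t => t%:R * f t)) => [s|t]; first by rewrite mulr_ge0.
apply: le_trans (hM t); rewrite trunc_hitE// lerDl mulr_ge0// subr_ge0.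
exact: F1.
Qed.

Lemma connected_degree_gt0 (V : finType) (e : rel V) (x y : V) :
  connected_graph e -> x != y -> (0 < degree e x)%N.
Proof.
move=> [_ /(_ x y)/connectP[[|z p] /= + ->]]; first by rewrite eqxx.
by move=> /andP[exz _] _; exact: degree_gt0 exz.
Qed.

Lemma kemeny_bound (R : realType) (V : finType) (e : rel V) (M : V -> R) :
  connected_graph e ->
  (forall j, 0 <= M j) ->
  (forall i j t, i != j -> trunc_hit R e j t i <= M j) ->
  (0 <= kemeny R e
     <= (\sum_j (degree e j)%:R / (2 * #|edges e|%:R) * M j)%:E)%E.
Proof.
move=> ce M0 hM; rewrite /kemeny.
have w0 j : 0 <= (degree e j)%:R / (2 * #|edges e|%:R) :> R.
  by rewrite divr_ge0// mulr_ge0.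
have tot0 : 0 <= \sum_j (degree e j)%:R / (2 * #|edges e|%:R) * M j.
  by apply: sumr_ge0 => j _; rewrite mulr_ge0.
case: pickP => [i _|_]; last by rewrite lexx /= lee_fin.
have hit j : j != i -> (0 <= expected_hit R e i j <= (M j)%:E)%E.
  move=> ji; apply: expected_hit_bound => [y|t].
    exact: connected_degree_gt0 ce.
  by apply: hM; rewrite eq_sym.
rewrite /kemeny_from; apply/andP; split.
  by apply: sume_ge0 => j /hit/andP[h0 _]; rewrite mule_ge0// lee_fin.
apply: (@le_trans _ _
    (\sum_(j | j != i) ((degree e j)%:R / (2 * #|edges e|%:R) * M j)%:E)%E).
  apply: lee_sum => j /hit/andP[_ hle].
  by rewrite [leRHS]EFinM; apply: lee_wpmul2l => //; rewrite lee_fin.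
rewrite sumEFin lee_fin [leRHS](bigD1 i)//= lerDr mulr_ge0//.
Qed.

(** * Hitting times and the total degree *)

Definition total_degree (V : finType) (e : rel V) : nat :=
  (\sum_x degree e x)%N.

(** For every target [j], a neighbour of [j] hits it in expected time at most
    the total degree.  The truncated expectation [u] satisfies
    [deg x * u x <= deg x + sum of u over the neighbours of x] off [j]; summing
    over [x != j] and exchanging the two sums, which is where the symmetry of the
    graph enters, leaves [sum of u over the neighbours of j] on the left. *)
Lemma trunc_hit_neighbour (R : realType) (V : finType) (e : rel V) (j y : V)
    (t : nat) :
  symmetric e -> e y j -> trunc_hit R e j t y <= (total_degree e)%:R.
Proof.
move=> se eyj; pose u := trunc_hit R e j t.
have u0 x : 0 <= u x by exact: trunc_hit_ge0.
have uj : u j = 0 by exact: trunc_hit_target.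
have sub x : x != j ->
    (degree e x)%:R * u x <= (degree e x)%:R + \sum_(z | e x z) u z.
  move=> xj; have [d0|d0] := posnP (degree e x).
    by rewrite d0 mul0r add0r sumr_ge0.
  have dR : 0 < (degree e x)%:R :> R by rewrite ltr0n.
  have : u x <= 1 + walk_avg e u x.
    by apply: le_trans (trunc_hit_mono _ _ _ _ _) _; rewrite /= (negPf xj).
  rewrite walk_avgE -(ler_pM2l dR) => /le_trans; apply.
  by rewrite mulrDr mulr1 mulrCA divff ?mulr1// gt_eqF.
have lhsE : \sum_(x | x != j) (degree e x)%:R * u x
    = \sum_z \sum_(x | e x z) u z.
  rewrite [RHS](bigD1 j)//= uj [X in X + _]big1 // add0r.
  apply: eq_bigr => x _; rewrite mulrC -sum_neighbour_cst.
  by apply: eq_bigl => z; rewrite se.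
have : \sum_(x | x != j) (degree e x)%:R * u x
    <= \sum_(x | x != j) ((degree e x)%:R + \sum_(z | e x z) u z).
  by apply: ler_sum => x; exact: sub.
rewrite lhsE big_split /= (exchange_big_dep predT) //= [leLHS](bigD1 j)//=.
rewrite lerD2r => le_deg.
have uy : u y <= \sum_(z | e j z) u z.
  by rewrite (bigD1 y) /=; [rewrite lerDl sumr_ge0|rewrite se].
rewrite (le_trans uy) // (le_trans le_deg) // /total_degree natr_sum.
by rewrite [leRHS](bigD1 j)//= lerDr.
Qed.

(** To hit [j] it suffices to hit [y] and then to hit [j] from there. *)
Lemma trunc_hit_triangle (R : realType) (V : finType) (e : rel V) (j y : V)
    (t : nat) (x : V) :
  trunc_hit R e j t x <= trunc_hit R e y t x + trunc_hit R e j t y.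
Proof.
elim: t x => [|t IH] x; first by rewrite addr0.
have [->|xy] := eqVneq x y; first by rewrite trunc_hit_target add0r.
have [->|xj] := eqVneq x j.
  by rewrite trunc_hit_target addr_ge0 ?trunc_hit_ge0.
rewrite [leLHS]/= [X in _ <= X + _]/= (negPf xj) (negPf xy) -addrA lerD2l.
apply: (@le_trans _ _ (walk_avg e (trunc_hit R e y t) x + trunc_hit R e j t y)).
  rewrite !walk_avgE; have [d0|d0] := posnP (degree e x).
    by rewrite d0 invr0 !mulr0 add0r trunc_hit_ge0.
  rewrite -!walk_avgE -(walk_avg_cst (trunc_hit R e j t y) d0) -walk_avgD.
  by apply: le_walk_avg => z _; apply: IH.
by rewrite lerD2l trunc_hit_mono.
Qed.

Lemma trunc_hit_path (R : realType) (V : finType) (e : rel V) (t : nat) (x : V)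
    (p : seq V) :
  symmetric e -> path e x p ->
  trunc_hit R e (last x p) t x <= (total_degree e * size p)%:R.
Proof.
move=> se; elim: p x => [|y p IH] x /=; first by rewrite trunc_hit_target.
move=> /andP[exy pyp]; rewrite mulnS natrD.
apply: le_trans (trunc_hit_triangle R e (last y p) y t x) _.
by apply: lerD; [exact: trunc_hit_neighbour|exact: IH].
Qed.

Lemma trunc_hit_connected (R : realType) (V : finType) (e : rel V) (i j : V)
    (t : nat) :
  symmetric e -> connected_graph e ->
  trunc_hit R e j t i <= (total_degree e * #|V|)%:R.
Proof.
move=> se [_ /(_ i j)/connectP[p ep ->]].
case/shortenP: ep => p' ep' up' _.
apply: le_trans (trunc_hit_path R t se ep') _.
rewrite ler_nat leq_mul2l; apply/orP; right.
apply: leq_trans (leqnSn _) _.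
by rewrite -[(size p').+1]/(size (i :: p')) -(card_uniqP up') max_card.
Qed.

Lemma total_degree_pairs (V : finType) (e : rel V) :
  total_degree e = #|[set p : V * V | e p.1 p.2]|.
Proof.
rewrite /total_degree -sum1dep_card.
under eq_bigr => x _ do rewrite /degree -sum1dep_card.
by rewrite pair_big_dep.
Qed.

(** Each edge carries at most two ordered pairs. *)
Lemma total_degree_le_edges (V : finType) (e : rel V) :
  (total_degree e <= 2 * #|edges e|)%N.
Proof.
rewrite total_degree_pairs /edges -sum1_card.
rewrite (partition_big_imset (fun p : V * V => [set p.1; p.2])) /=.
rewrite mulnC -sum_nat_const; apply: leq_sum => s /imsetP[[x y] _ ->] /=.
rewrite sum1dep_card; apply: (@leq_trans #|[set (x, y); (y, x)]|); last first.
  by rewrite cards2; case: (_ != _).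
apply/subset_leq_card/fintype.subsetP => -[a b].
rewrite !inE => /andP[_ /eqP/setP /= eq_ab]; rewrite !xpair_eqE.
have := eq_ab x; have := eq_ab y; have := eq_ab a; have := eq_ab b.
rewrite !inE !eqxx !orbT /= (eq_sym x a) (eq_sym y a) (eq_sym x b) (eq_sym y b).
by case: (a == x); case: (a == y); case: (b == x); case: (b == y).
Qed.

(** * Acyclic graphs *)

Definition avoiding (V : finType) (e : rel V) (x : V) : rel V :=
  [rel u v | [&& e u v, u != x & v != x]].

(** Otherwise a path between the two neighbours that avoids [x] closes to a
    cycle through [x]. *)
Lemma acyclic_neighbour_unique (V : finType) (e : rel V) (x y z : V) :
  simple_graph e -> acyclic_graph e ->
  e x y -> e x z -> connect (avoiding e x) y z -> y = z.
Proof.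
move=> [se ie] ae exy exz /connectP[p ep zE].
case: (shortenP ep) zE => p' ep' up' _ zE.
case: p' ep' up' zE => [|w p'] ep' up' zE; first by [].
have /ae // : ucycle e [:: x, y, w & p'].
apply/andP; split.
  rewrite /cycle rcons_path -[last _ _]/(last y (w :: p')) -zE se exz andbT.
  rewrite [path _ _ _]/(e x y && path e y (w :: p')) exy /=.
  by apply: sub_path ep' => u v /and3P[].
rewrite cons_uniq up' andbT.
rewrite inE negb_or; apply/andP; split.
  by apply/eqP => xy; move: exy; rewrite xy ie.
have: all (fun v => v != x) (w :: p').
  elim: (w :: p') y ep' {exy ep up' zE} => [|v s IH] y //=.
  by move=> /andP[/and3P[_ _ ->] /IH].
by apply: contraTN => xin; apply/allPn; exists x; rewrite ?eqxx.
Qed.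

(** Root the tree at [r].  The parent of [x] is its neighbour that is connected
    to [r] off [x]; it is unique by acyclicity, and every edge joins a vertex to
    its parent: a simple path from [x] to [r] either misses [y], or its part
    after [y] misses [x].  So each vertex accounts for at most two of the ordered
    adjacent pairs. *)
Lemma tree_total_degree (V : finType) (e : rel V) :
  tree e -> (total_degree e <= 2 * #|V|)%N.
Proof.
move=> [sge [V0 ce] ae]; have [se ie] := sge.
move: V0 => /card_gt0P[r _].
pose par x y := e x y && connect (avoiding e x) y r.
have par_inj x y z : par x y -> par x z -> y = z.
  move=> /andP[exy yr] /andP[exz zr].
  apply: (acyclic_neighbour_unique sge ae exy exz).
  apply: connect_trans yr _; rewrite sym_connect_sym//.
  by move=> u v; rewrite /avoiding /= se; congr andb; rewrite andbC.
have edge_par x y : e x y -> par x y || par y x.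
  move=> exy; have /connectP[p ep rE] := ce x r.
  case: (shortenP ep) rE => p' ep' up' _ rE.
  have off z a q : path e a q -> z \notin a :: q ->
      connect (avoiding e z) a (last a q).
    move=> eaq zaq; apply/connectP; exists q => //.
    elim: q a eaq zaq => //= b q IH a /andP[eab ebq].
    rewrite !inE !negb_or => /and3P[za zb zq].
    by rewrite /avoiding /= eab (eq_sym a) za (eq_sym b) zb IH// inE negb_or zb.
  case: (boolP (y \in x :: p')) => [|yp].
    rewrite inE => /orP[/eqP yx|yp]; first by move: exy; rewrite yx ie.
    apply/orP; left; rewrite /par exy rE /=.
    case/splitPr: yp ep' up' => p1 p2.
    rewrite cat_path last_cat /= => /andP[_ /andP[_ ep2]] /andP[xp _].
    by apply: off => //; move: xp; rewrite mem_cat negb_or => /andP[].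
  apply/orP; right; rewrite /par se exy /=.
  by rewrite rE; apply: off.
pose A := [set p : V * V | par p.1 p.2].
pose B := [set p : V * V | par p.2 p.1].
rewrite total_degree_pairs.
apply: (@leq_trans #|A :|: B|).
  by apply/subset_leq_card/fintype.subsetP => -[x y]; rewrite !inE; exact: edge_par.
apply: leq_trans (leq_card_setU A B) _; rewrite mul2n -addnn.
apply: leq_add.
  rewrite -(@card_in_imset _ _ (@fst V V)) ?max_card// => -[x y] [x' y'].
  by rewrite !inE /= => pxy pxy' xx'; rewrite -xx' in pxy' *;
    rewrite (par_inj _ _ _ pxy pxy').
rewrite -(@card_in_imset _ _ (@snd V V)) ?max_card// => -[x y] [x' y'].
by rewrite !inE /= => pxy pxy' yy'; rewrite -yy' in pxy' *;
    rewrite (par_inj _ _ _ pxy pxy').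
Qed.

(** All hitting times are at most [2 n * n], and the weights of Kemeny's constant
    sum to at most [1]. *)
Lemma tree_kemeny_bound (R : realType) (V : finType) (e : rel V) :
  tree e -> (0 <= kemeny R e <= (2 * #|V| ^ 2)%:R%:E)%E.
Proof.
move=> te; have [[se _] ce _] := te.
pose M := (total_degree e * #|V|)%:R : R.
have /andP[-> kle] : (0 <= kemeny R e <=
    (\sum_j (degree e j)%:R / (2 * #|edges e|%:R) * M)%:E)%E.
  apply: (@kemeny_bound R V e (fun=> M)) => // i j t _.
  exact: trunc_hit_connected.
apply: le_trans kle _; rewrite lee_fin.
rewrite -mulr_suml -mulr_suml -natr_sum -/(total_degree e).
apply: (@le_trans _ _ M); last first.
  by rewrite ler_nat expnS expn1 mulnA leq_mul2r tree_total_degree// orbT.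
apply: ler_piMl => //.
have le_edges := total_degree_le_edges e.
have [->|E0] := posnP #|edges e|; first by rewrite mulr0 invr0 mulr0.
by rewrite ler_pdivrMr ?mul1r -natrM ?ler_nat// ltr0n muln_gt0.
Qed.

(** * Complements of trees *)

Lemma compl_graph_sym (V : finType) (e : rel V) :
  symmetric e -> symmetric (compl_graph e).
Proof. by move=> se x y; rewrite /compl_graph /= se eq_sym. Qed.

Lemma degree_compl (V : finType) (e : rel V) (x : V) :
  irreflexive e -> (degree e x + degree (compl_graph e) x).+1 = #|V|.
Proof.
move=> ie; have V0 : (0 < #|V|)%N by apply/card_gt0P; exists x.
rewrite -(prednK V0) -(cardsC1 x) -(cardsID [set y | e x y] [set~ x]).
congr (_ + _).+1; apply: eq_card => y; rewrite !inE /=.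
  by case: eqVneq => // ->.
by rewrite /compl_graph /= eq_sym andbC.
Qed.

(** A tree has few edges, so its complement has almost all of them. *)
Lemma compl_total_degree (V : finType) (e : rel V) :
  tree e -> (#|V| ^ 2 <= total_degree (compl_graph e) + 3 * #|V|)%N.
Proof.
move=> te; have [[_ ie] _ _] := te.
have : (\sum_(x : V) (degree e x + degree (compl_graph e) x).+1
        = #|V| * #|V|)%N.
  by under eq_bigr => x _ do rewrite degree_compl//; rewrite sum_nat_const.
under eq_bigr => x _ do rewrite -addn1.
rewrite !big_split /= sum_nat_const muln1 -/(total_degree e).
rewrite -/(total_degree (compl_graph e)).
by have := tree_total_degree te; rewrite expnS expn1 -[#|xpredT|]/#|V|; lia.
Qed.

(** The exceptional vertices of the supersolution below: the walk on the
    complement has too few ways from them into the neighbourhood of [j]. *)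
Definition poor (V : finType) (e : rel V) (j x : V) : bool :=
  let g := compl_graph e in
  [&& x != j, ~~ g j x & (2 * #|[set y | g x y & g j y]| < degree g j)%N].

(** Two poor vertices are neighbours of [j] in the tree, and each of them is
    joined in the tree to more than half of the remaining vertices.  They share
    one of these, which closes a cycle of length four through [j]. *)
Lemma poor_unique (V : finType) (e : rel V) (j x y : V) :
  tree e -> poor e j x -> poor e j y -> x = y.
Proof.
move=> [[se ie] _ ae]; set g := compl_graph e => px py.
have tree_edge u : poor e j u -> e j u.
  by move=> /and3P[uj + _]; rewrite /compl_graph /= eq_sym uj /= negbK.
have far_card u : poor e j u ->
    (degree g j < 2 * #|[set z | g j z & ~~ g u z]|)%N.
  move=> /and3P[_ _]; rewrite -/g.
  have -> : degree g j = (#|[set z | g u z & g j z]|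
      + #|[set z | g j z & ~~ g u z]|)%N.
    rewrite /degree -(cardsID [set z | g u z] [set z | g j z]); congr addn.
      by apply: eq_card => z; rewrite !inE andbC.
    by apply: eq_card => z; rewrite !inE andbC.
  by lia.
have far_edge u z : poor e j u -> g j z -> ~~ g u z -> e u z.
  move=> /and3P[_ guj _] gjz; rewrite /g /compl_graph /= negb_and !negbK.
  by case/orP => // /eqP uz; move: guj; rewrite uz -/g gjz.
have [z /andP[/andP[gjz gxz] gyz]] :
    exists z, g j z && ~~ g x z && ~~ g y z.
  apply/existsP; apply: contraT; rewrite negb_exists => /forallP none.
  have := cardsUI [set z | g j z & ~~ g x z] [set z | g j z & ~~ g y z].
  have -> : [set z | g j z & ~~ g x z] :&: [set z | g j z & ~~ g y z] = finset.set0.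
    apply/setP => z; rewrite !inE; have := none z.
    by case: (g j z); case: (g x z); case: (g y z).
  rewrite cards0 addn0.
  have : (#|[set z | g j z & ~~ g x z] :|: [set z | g j z & ~~ g y z]|
      <= degree g j)%N.
    by apply/subset_leq_card/fintype.subsetP => z; rewrite !inE => /orP[]/andP[].
  by have := far_card x px; have := far_card y py; lia.
have [xj _ _] := and3P px; have [yj _ _] := and3P py.
have zj : z != j by move: gjz; rewrite /g /compl_graph /= eq_sym => /andP[].
apply: (acyclic_neighbour_unique (conj se ie) ae (tree_edge x px) (tree_edge y py)).
apply: (@connect_trans _ _ z); apply: connect1; rewrite /avoiding /=.
  by rewrite (far_edge x z px gjz gxz) xj zj.
by rewrite se (far_edge y z py gjz gyz) yj zj.
Qed.

(** With [k] the degree of [j] in the complement, the supersolution is [0] at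
    [j], [a] at the neighbours of [j], [c] at a poor vertex and [c - 1]
    elsewhere.  A neighbour of [j] hits [j] with probability at least [1 / n]; a
    vertex of the last kind steps to a neighbour of [j] with probability at least
    [k / (2 n)]; and from a poor vertex every step leads to a vertex that is not
    poor. *)
Lemma compl_trunc_hit (R : realType) (V : finType) (e : rel V) (i j : V)
    (t : nat) :
  tree e -> connected_graph (compl_graph e) -> i != j ->
  trunc_hit R (compl_graph e) j t i
    <= 11 * #|V|%:R ^+ 2 / (degree (compl_graph e) j)%:R.
Proof.
move=> te cg ij; set g := compl_graph e.
have [[se ie] _ _] := te.
have sg : symmetric g by exact: compl_graph_sym.
have dle x : (degree g x)%:R <= #|V|%:R :> R by rewrite ler_nat max_card.
have k0 : 0 < (degree g j)%:R :> R.
  by rewrite ltr0n; apply: (connected_degree_gt0 cg (y := i)); rewrite eq_sym.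
have n1 : 1 <= #|V|%:R :> R by rewrite ler1n; apply/card_gt0P; exists j.
have kn := dle j.
set n := #|V|%:R in dle n1 kn *; set k := (degree g j)%:R in k0 kn *.
have n0 : 0 < n by apply: lt_le_trans n1.
have k_neq0 : k != 0 by rewrite gt_eqF.
have n_neq0 : n != 0 by rewrite gt_eqF.
(* The values solve the inequalities of the supersolution.  At a neighbour of
   [j], [1 + c - c / n <= a] follows from [c >= a = n * (r + 2)] and
   [c - a = r + 1]; at a vertex that is not poor,
   [1 + c - (r + 1) * k / (2 n) <= c - 1] follows from [r * k / (2 n) = 2]. *)
pose r := 4 * n / k.
have r0 : 0 <= r by rewrite divr_ge0 ?mulr_ge0 ?ltW.
pose a := n * (r + 2).
have a0 : 0 <= a by rewrite mulr_ge0 ?addr_ge0// ltW.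
pose c := a + r + 1.
have c0 : 0 <= c by rewrite /c; lra.
pose h x := if x == j then 0 else if g j x then a else
  if poor e j x then c else c - 1.
have h0 x : 0 <= h x by rewrite /h; do 3?case: ifP => _ //; rewrite /c; lra.
have hc x : h x <= c by rewrite /h; do 3?case: ifP => _ //; rewrite /c; lra.
have hB x : g j x -> h x <= a by rewrite /h => ->; case: ifP.
have hrich x : ~~ poor e j x -> h x <= c - 1.
  by rewrite /h => /negPf ->; do 2?case: ifP => _ //; rewrite /c; lra.
apply: (@le_trans _ _ (h i)); last first.
  apply: le_trans (hc i) _; rewrite ler_pdivlMr//.
  have -> : c * k = 4 * n ^+ 2 + 2 * n * k + 4 * n + k.
    by rewrite /c /a /r; field.
  by nra.
apply: trunc_hit_le_supersol => // x xj.
have d0 := connected_degree_gt0 cg xj; rewrite -/g in d0.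
rewrite {2}/h (negPf xj); case: ifPn => [gjx|gjx].
  have drop : r + 2 <= c * n^-1.
    by rewrite ler_pdivlMr// mulrC -/a /c; lra.
  have hle : walk_avg g h x <= c - c * n^-1.
    have := @walk_avg_drop R V g h x (pred1 j) c c n^-1 d0 c0 (fun y _ => hc y).
    have -> : #|[set y | g x y & pred1 j y]| = 1%N.
      rewrite -(cards1 j); apply: eq_card => y; rewrite !inE /=.
      by case: eqVneq => [->|_]; rewrite ?andbF// sg gjx.
    apply; first by move=> y _ /eqP ->; rewrite /h eqxx subrr.
    by rewrite mulrC ler_pdivrMr// mul1r.
  by rewrite /c in hle drop *; lra.
case: ifPn => [px|rich].
  have hle : walk_avg g h x <= c - 1 * 1.
    apply: (@walk_avg_drop R V g h x predT) => // [y gxy _|].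
      apply: hrich; apply: contraTN gxy => py.
      by rewrite (poor_unique te px py) /g /compl_graph /= eqxx.
    rewrite mul1r ler_nat; apply/subset_leq_card/fintype.subsetP => y.
    by rewrite !inE andbT.
  by lra.
have hle : walk_avg g h x <= c - (r + 1) * (k / (2 * n)).
  apply: (@walk_avg_drop R V g h x (g j)) => // [|y _ gjy|].
  - by lra.
  - by apply: le_trans (hB y gjy) _; rewrite /c; lra.
  move: rich; rewrite /poor xj gjx /= -leqNgt -/g => rich.
  have : k <= 2 * #|[set y | g x y & g j y]|%:R by rewrite -natrM ler_nat.
  have : k / (2 * n) * (degree g x)%:R <= k / 2.
    rewrite mulrAC ler_pdivrMr ?mulr_gt0//.
    have -> : k / 2 * (2 * n) = k * n by field.
    by rewrite ler_wpM2l// ltW.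
  by lra.
have drop : (r + 1) * (k / (2 * n)) = 2 + k / (2 * n).
  by rewrite /r; field; rewrite k_neq0 n_neq0.
have : 0 <= k / (2 * n) by rewrite divr_ge0 ?mulr_ge0 ?ltW.
by lra.
Qed.

(** The degrees in the weights of Kemeny's constant cancel those in the bounds
    on the hitting times. *)
Lemma compl_tree_kemeny_bound (R : realType) (V : finType) (e : rel V) :
  tree e -> connected_graph (compl_graph e) -> (4 <= #|V|)%N ->
  (0 <= kemeny R (compl_graph e) <= (44 * #|V|)%:R%:E)%E.
Proof.
move=> te cg V4; set g := compl_graph e.
pose n : R := #|V|%:R; have n0 : 0 < n by rewrite ltr0n; apply: leq_trans V4.
pose M j : R := 11 * n ^+ 2 / (degree g j)%:R.
have M0 j : 0 <= M j by rewrite divr_ge0 ?mulr_ge0 ?exprn_ge0// ltW.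
have /andP[-> kle] := @kemeny_bound R V g M cg M0
  (fun i j t ij => compl_trunc_hit R t te cg ij).
apply: le_trans kle _; rewrite lee_fin.
pose E : R := 2 * #|edges g|%:R.
have E_ge : n ^+ 2 <= 4 * E.
  rewrite /E /n -natrX -!natrM ler_nat.
  have := compl_total_degree te; have := total_degree_le_edges g.
  by move: V4; rewrite -/g !expnS expn0; nia.
have E0 : 0 < E by have := exprn_gt0 2 n0; lra.
apply: (@le_trans _ _ (\sum_(j : V) 11 * n ^+ 2 / E)).
  apply: ler_sum => j _; rewrite -/E /M.
  have [->|d0] := posnP (degree g j).
    by rewrite mul0r mul0r divr_ge0 ?mulr_ge0 ?exprn_ge0// ltW.
  have dR : (degree g j)%:R != 0 :> R by rewrite pnatr_eq0 -lt0n.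
  have -> // : (degree g j)%:R / E * (11 * n ^+ 2 / (degree g j)%:R)
      = 11 * n ^+ 2 / E.
  by field; rewrite dR gt_eqF.
rewrite sumr_const -[#|xpredT|]/#|V| -[leLHS]mulr_natr -/n natrM -/n.
rewrite [leLHS]mulrAC ler_pdivrMr//.
have := ler_wpM2l (ltW n0) E_ge.
by rewrite (_ : 44%N%:R = 44 :> R)//; lra.
Qed.

Local Open Scope classical_set_scope.
Local Open Scope ring_scope.

(** * Asymptotics *)

(** Nonnegativity alone does not bound the limit superior from below: along a
    bounded [N] the filter would contain the empty set, whose supremum is [-oo]. *)
Lemma limf_esup_fin_num (R : realType) (N : set nat) (f : nat -> \bar R)
    (k : nat) (C : R) :
  infinite_set N ->
  (forall n, N n -> (k <= n)%N -> (0 <= f n <= C%:E)%E) ->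
  limf_esup f (within N \oo) \is a fin_num.
Proof.
move=> Ninf fC; rewrite ge0_fin_numE; last first.
  apply: le_ereal_inf_tmp => _ [V [m _ mV] <-].
  have [n [Nn kn mn]] : exists n, [/\ N n, (k <= n)%N & (m <= n)%N].
    apply: contrapT => none; apply: Ninf.
    apply: (sub_finite_set _ (finite_II (maxn k m))) => n Nn /=.
    rewrite ltnNge geq_max; apply/negP => /andP[kn mn].
    by apply: none; exists n.
  have /andP[fn0 _] := fC n Nn kn.
  by apply: le_trans fn0 _; apply: ereal_sup_ubound; exists n => //; apply: mV.
apply: (@le_lt_trans _ _ C%:E); last exact: ltry.
apply: (@le_trans _ _ (ereal_sup (f @` [set n | N n /\ (k <= n)%N]))).
  apply: ereal_inf_lbound; exists [set n | N n /\ (k <= n)%N] => //.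
  by exists k.
by apply: ge_ereal_sup => _ [n [Nn kn] <-]; case/andP: (fC n Nn kn).
Qed.

Theorem mainTheorem7 (R : realType) (N : set nat) (T : forall n : nat, rel 'I_n)
    (hN : infinite_set N) (hNpos : forall n, N n -> (0 < n)%N)
    (hT : forall n, N n -> tree (T n))
    (hTc : forall n, N n -> connected_graph (compl_graph (T n))) :
  limf_esup
    (fun n => kemeny R (T n) * kemeny R (compl_graph (T n))
                / (n%:R ^+ 3)%:E)%E
    (within N \oo) \is a fin_num.
Proof.
apply: (@limf_esup_fin_num R N _ 4 88) => // n Nn n4.
have := tree_kemeny_bound R (hT n Nn).
have := compl_tree_kemeny_bound R (hT n Nn) (hTc n Nn).
rewrite card_ord => /(_ n4) /andP[g0 gle] /andP[t0 tle].
have n0 : (0 : R) < n%:R by rewrite ltr0n; apply: leq_trans n4.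
rewrite inver gt_eqF ?exprn_gt0//; apply/andP; split.
  by rewrite mule_ge0 ?mule_ge0// lee_fin invr_ge0 exprn_ge0// ltW.
rewrite lee_pdivrMr ?exprn_gt0//.
apply: le_trans (lee_pmul t0 g0 tle gle) _.
rewrite -!EFinM lee_fin !natrM.
by rewrite le_eqVlt; apply/orP; left; apply/eqP; ring.
Qed.
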